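(* Let $R$ be a $J$-regular ring and let $n\geq 1$ be an integer. Then $R$ is right $n$-injective if and only if every homomorphism of right $R$-modules from an $n$-generated small right ideal of $R$ to $R_R$ can be extended to a homomorphism from $R_R$ to $R_R$.
   Context: Rings are associative with identity, not necessarily commutative. $J=J(R)$ denotes the Jacobson radical of $R$. A ring is called regular if it is von Neumann regular (for every $a$ there is $b$ with $a=aba$). A ring $R$ is called $J$-regular if $R/J(R)$ is regular. $R_R$ denotes $R$ as a right module over itself. A right ideal is $n$-generated if it can be written as $a_1R+\cdots+a_nR$ with $a_1,\dots,a_n\in R$. A right ideal $L$ of $R$ is small if $L+K\neq R$ for every proper right ideal $K$ of $R$. A ring $R$ is right $n$-injective if every homomorphism from an $n$-generated right ideal of $R$ to $R_R$ can be extended to a homomorphism from $R_R$ to $R_R$. *)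

(* Defs.v *)
From HB Require Import structures.
From mathcomp Require Import all_boot all_algebra boolp.

Set Implicit Arguments.
Unset Strict Implicit.
Unset Printing Implicit Defensive.

Import GRing.Theory.

Local Open Scope ring_scope.
Local Open Scope quotient_scope.

(* The base structure is pzRingType, so that the zero ring is allowed.

   Right R-modules are left modules over the converse ring R^c.  In particular
   R_R is R^c^o: its carrier is convertible to R and its scalar action is
   a *: x = x * a, the product being that of R.  A right ideal is a submodule
   of R_R.  Membership in a submodClosed predicate is boolean; this excludes no
   right ideal, since boolp decides every proposition. *)
Notation rideal R := (submodClosed R^c^o).

Section RightIdealModule.
Variables (R : pzRingType) (L : rideal R).

Record rideal_mod := RidealMod {
  rideal_val : R^c^o;
  rideal_valP : rideal_val \in L
}.

HB.instance Definition _ := [isSub for rideal_val].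
HB.instance Definition _ := [Choice of rideal_mod by <:].
HB.instance Definition _ := [SubChoice_isSubLmodule of rideal_mod by <:].

End RightIdealModule.

Section RightIdeals.
Variable R : pzRingType.
Implicit Types L K M : rideal R.

Definition n_generated (n : nat) L : Prop :=
  exists a : 'I_n -> R, forall x : R,
    x \in L <-> exists r : 'I_n -> R, x = \sum_(i < n) a i * r i.

Definition proper_rideal K : Prop := exists x : R, x \notin K.

Definition small_rideal L : Prop :=
  forall K, proper_rideal K ->
    ~ (forall x : R, exists l k : R, [/\ l \in L, k \in K & x = l + k]).

Definition maximal_rideal M : Prop :=
  proper_rideal M /\
  forall K, {subset M <= K} -> proper_rideal K -> {subset K <= M}.

Definition extends_to_ring L (f : {linear rideal_mod L -> R^c^o}) : Prop :=
  exists g : {linear R^c^o -> R^c^o}, forall x : rideal_mod L, g (val x) = f x.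

End RightIdeals.

Definition jacobson (R : pzRingType) : {pred R} :=
  fun x => `[< forall M : rideal R, maximal_rideal M -> x \in M >].
Arguments jacobson : clear implicits.

Section JacobsonIdeal.
Variable R : pzRingType.
Implicit Types K M : rideal R.

Lemma jacobsonP (x : R) :
  reflect (forall M, maximal_rideal M -> x \in M) (x \in jacobson R).
Proof. exact: asboolP. Qed.

Lemma rideal0 M : (0 : R) \in M.
Proof. exact: (@rpred0 _ M). Qed.

Lemma ridealD M (x y : R) : x \in M -> y \in M -> (x + y : R) \in M.
Proof. exact: (@rpredD _ M x y). Qed.

Lemma ridealM M (x r : R) : x \in M -> (x * r : R) \in M.
Proof. exact: (@rpredZ _ _ M r x). Qed.

Lemma ridealB M (x y : R) : x \in M -> y \in M -> (x - y : R) \in M.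
Proof.
by move=> Mx My; rewrite -mulrN1; apply/ridealD/ridealM.
Qed.

Lemma proper_rideal1 M : proper_rideal M -> (1 : R) \notin M.
Proof.
by move=> [x]; apply: contra => M1; rewrite -[x]mul1r; apply: ridealM.
Qed.

Lemma jacobson_zmod_closed : zmod_closed (jacobson R).
Proof.
split=> [|x y /jacobsonP Jx /jacobsonP Jy]; apply/jacobsonP => M maxM.
  exact: rideal0.
exact: ridealB (Jx M maxM) (Jy M maxM).
Qed.

HB.instance Definition _ :=
  GRing.isZmodClosed.Build R (jacobson R) jacobson_zmod_closed.

Lemma jacobsonMr (x r : R) : x \in jacobson R -> x * r \in jacobson R.
Proof.
by move=> /jacobsonP Jx; apply/jacobsonP => M maxM; apply/ridealM/Jx.
Qed.

Definition rideal_colon M (r : R) : {pred R^c^o} := fun y => (r * y : R) \in M.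

Lemma rideal_colon_closed M r : GRing.submod_closed (rideal_colon M r).
Proof.
split=> [|a x y]; rewrite /in_mem /= /rideal_colon.
  by rewrite (_ : r * 0 = 0) ?mulr0 //; exact: rideal0.
move=> Mx My; rewrite (_ : r * _ = r * (x : R) * (a : R) + r * (y : R)).
  exact: ridealD (@ridealM M _ a Mx) My.
by rewrite -mulrA -mulrDr.
Qed.

HB.instance Definition _ M r :=
  GRing.isSubmodClosed.Build R^c R^c^o (rideal_colon M r)
    (rideal_colon_closed M r).

Definition rideal_sum (r : R) K M : {pred R^c^o} :=
  fun y => `[< exists k m : R, [/\ k \in K, m \in M & y = r * k + m :> R] >].

Lemma rideal_sum_closed r K M : GRing.submod_closed (rideal_sum r K M).
Proof.
split=> [|a x y].
  apply/asboolP; exists 0, 0; split; [exact: rideal0|exact: rideal0|].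
  by rewrite mulr0 addr0.
move=> /asboolP[k [m [Kk Mm ex]]] /asboolP[k' [m' [Kk' Mm' ey]]].
apply/asboolP; exists (k * (a : R) + k'), (m * (a : R) + m'); split.
- exact: ridealD (@ridealM K _ a Kk) Kk'.
- exact: ridealD (@ridealM M _ a Mm) Mm'.
rewrite (_ : a *: x + y = (x : R) * (a : R) + y :> R) // ex ey.
by rewrite mulrDl mulrDr !mulrA addrACA.
Qed.

HB.instance Definition _ r K M :=
  GRing.isSubmodClosed.Build R^c R^c^o (rideal_sum r K M)
    (rideal_sum_closed r K M).

Lemma maximal_rideal_colon M (r : R) :
  maximal_rideal M -> r \notin M -> maximal_rideal (rideal_colon M r : rideal R).
Proof.
move=> [prM maxM] Mr; split.
  by exists 1; rewrite /in_mem /= /rideal_colon mulr1.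
move=> K sMK prK x Kx.
have sMS : {subset M <= rideal_sum r K M}.
  move=> m Mm; apply/asboolP; exists 0, m; split=> //; first exact: rideal0.
  by rewrite mulr0 add0r.
have SrK (y : R) : y \in K -> (r * y : R) \in rideal_sum r K M.
  move=> Ky; apply/asboolP; exists y, 0; split=> //; first exact: rideal0.
  by rewrite addr0.
have [Sr|nSr] := boolP ((r : R) \in rideal_sum r K M); last first.
  by apply: (maxM (rideal_sum r K M : rideal R)) => //; [exists r|exact: SrK].
have [k [m [Kk Mm er]]] := asboolW Sr.
have K1k : (1 - k : R) \in K.
  apply: sMK; rewrite /in_mem /= /rideal_colon mulrBr mulr1 {1}er.
  by rewrite addrAC subrr add0r.
case/negP: (proper_rideal1 prK).
by rewrite -[1](subrK k); apply: ridealD.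
Qed.

Lemma jacobsonMl (r x : R) : x \in jacobson R -> r * x \in jacobson R.
Proof.
move=> /jacobsonP Jx; apply/jacobsonP => M maxM.
have [Mr|Mr] := boolP ((r : R) \in M); first exact: ridealM.
exact: (Jx _ (maximal_rideal_colon maxM Mr)).
Qed.

(* As an additive group, R / J(R) is the library's quotient; the library only
   provides the multiplication for commutative rings. *)
Definition jacobson_quot : Type := Quotient.quot (jacobson R).

HB.instance Definition _ := GRing.Zmodule.on jacobson_quot.
HB.instance Definition _ := ZmodQuotient.on jacobson_quot.

Let Q := jacobson_quot.

Definition jacobson_quot_mul (x y : Q) : Q := \pi_Q (repr x * repr y).

Lemma jacobson_quot_piM (x y : R) :
  \pi_Q (x * y) = jacobson_quot_mul (\pi_Q x) (\pi_Q y).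
Proof.
rewrite /jacobson_quot_mul; set x' := repr _; set y' := repr _.
apply/eqP; rewrite -Quotient.idealrBE.
have Jx : x - x' \in jacobson R by rewrite Quotient.idealrBE reprK.
have Jy : y - y' \in jacobson R by rewrite Quotient.idealrBE reprK.
rewrite (_ : x * y - x' * y' = (x - x') * y + x' * (y - y')).
  by apply: rpredD; [exact: jacobsonMr | exact: jacobsonMl].
by rewrite mulrBl mulrBr addrA subrK.
Qed.

Lemma jacobson_quot_mulA : associative jacobson_quot_mul.
Proof.
move=> x y z; rewrite -[x]reprK -[y]reprK -[z]reprK.
rewrite -(jacobson_quot_piM (repr y)) -(jacobson_quot_piM (repr x)).
by rewrite -(jacobson_quot_piM (repr x)) -jacobson_quot_piM mulrA.
Qed.

Lemma jacobson_quot_mul1x : left_id (\pi_Q 1) jacobson_quot_mul.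
Proof. by move=> x; rewrite -[x]reprK -jacobson_quot_piM mul1r. Qed.

Lemma jacobson_quot_mulx1 : right_id (\pi_Q 1) jacobson_quot_mul.
Proof. by move=> x; rewrite -[x]reprK -jacobson_quot_piM mulr1. Qed.

Lemma jacobson_quot_mulDl : left_distributive jacobson_quot_mul +%R.
Proof.
move=> x y z; rewrite -[x]reprK -[y]reprK -[z]reprK.
by rewrite -raddfD -!jacobson_quot_piM mulrDl raddfD.
Qed.

Lemma jacobson_quot_mulDr : right_distributive jacobson_quot_mul +%R.
Proof.
move=> x y z; rewrite -[x]reprK -[y]reprK -[z]reprK.
by rewrite -raddfD -!jacobson_quot_piM mulrDr raddfD.
Qed.

HB.instance Definition _ := GRing.Zmodule_isPzRing.Build jacobson_quot
  jacobson_quot_mulA jacobson_quot_mul1x jacobson_quot_mulx1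
  jacobson_quot_mulDl jacobson_quot_mulDr.

End JacobsonIdeal.
Arguments jacobson_quot : clear implicits.

Definition regular_ring (S : pzRingType) : Prop :=
  forall a : S, exists b : S, a = a * b * a.

Definition J_regular (R : pzRingType) : Prop := regular_ring (jacobson_quot R).

Definition right_n_injective (n : nat) (R : pzRingType) : Prop :=
  forall L : rideal R, n_generated n L ->
    forall f : {linear rideal_mod L -> R^c^o}, extends_to_ring f.

(* Main.v *)
Require Import Defs.
From HB Require Import structures.
From mathcomp Require Import all_boot all_algebra.
From mathcomp Require Import boolp classical_sets.

(** Only the extension of homomorphisms to arbitrary [n]-generated right ideals
    is at stake.  Let [L = a_1 R + ... + a_n R].  Since [R/J] is regular, the
    image of [L] in [R/J] has a left identity, which lifts to an element [e] of
    [L] with [(1 - e) L] contained in [J].  This [e] is idempotent modulo [J]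
    only: idempotents of [R/J] need not lift to idempotents of [R].

    The right ideal [(1 - e) L] is generated by the [n] elements
    [(1 - e) a_i]; it lies in [L] because [e] does, and it is small because it
    lies in [J].  So, given [f : L -> R], the restriction of [f] to
    [(1 - e) L] extends to [R], that is, it is left multiplication by some
    [c].  For every [x] in [L] the
    elements [(1 - e) x] and [e] are both in [L], hence
      [f x = f ((1 - e) x) + f (e x) = c (1 - e) x + f e x],
    and [f] is left multiplication by [c (1 - e) + f e].

    The two ingredients are the left identity modulo [J]
    ([J_regular_left_identity]), built one generator at a time, and the
    smallness of the right ideals inside [J] ([small_sub_jacobson]), which
    rests on the existence of maximal right ideals. *)

Set Implicit Arguments.
Unset Strict Implicit.
Unset Printing Implicit Defensive.

Import GRing.Theory.

Local Open Scope ring_scope.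

Section MaximalRightIdeals.
Variable R : pzRingType.
Implicit Types K L M : rideal R.

(** [K] is included in the union so that an empty chain of right ideals above
    [K] also has a right ideal as its union. *)
Definition rideal_union K (A : set (rideal R)) : {pred R^c^o} :=
  fun x => `[< x \in K \/ exists2 M : rideal R, A M & x \in M >].

Lemma rideal_union_closed K (A : set (rideal R)) :
  (forall M, A M -> {subset K <= M}) ->
  total_on A (fun M N => {subset M <= N}) ->
  GRing.submod_closed (rideal_union K A).
Proof.
move=> sKA totA; split=> [|a x y]; first by apply/asboolP; left; apply: rpred0.
have lin M : x \in M -> y \in M -> a *: x + y \in M.
  by move=> Mx My; apply: rpredD => //; apply: rpredZ.
move=> /asboolP[Kx|[M AM Mx]] /asboolP[Ky|[N AN Ny]]; apply/asboolP.
- by left; apply: lin.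
- by right; exists N => //; apply: lin => //; apply: sKA Kx.
- by right; exists M => //; apply: lin => //; apply: sKA Ky.
- have [sMN|sNM] := totA M N AM AN.
    by right; exists N => //; apply: lin => //; apply: sMN.
  by right; exists M => //; apply: lin => //; apply: sNM.
Qed.

(** Properness is inherited by unions of chains because it only says that the
    ideal avoids [1]; Zorn's lemma then applies to the proper right ideals
    above [K]. *)
Lemma maximal_rideal_exists K : proper_rideal K ->
  exists2 M : rideal R, maximal_rideal M & {subset K <= M}.
Proof.
move=> prK.
pose T := {M : rideal R | proper_rideal M /\ {subset K <= M}}.
pose le (s t : T) := `[< {subset sval s <= sval t} >].
have le_refl t : le t t by apply/asboolP.
have le_trans r s t : le r s -> le s t -> le r t.
  by move=> /asboolP rs /asboolP st; apply/asboolP => x /rs /st.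
have t0 : T by exists K; split.
have [A totA|[M [prM sKM]] maxM] := ZL_preorder t0 le_refl le_trans.
  pose A' : set (rideal R) := fun M => exists2 t, A t & sval t = M.
  have sKA' M : A' M -> {subset K <= M} by move=> [[N [prN sKN]] _ <-].
  have totA' : total_on A' (fun M N => {subset M <= N}).
    move=> _ _ [s As <-] [t At <-].
    by have [/asboolP|/asboolP] := totA s t As At; [left|right].
  pose U : rideal R := HB.pack_for (rideal R) (rideal_union K A')
    (GRing.isSubmodClosed.Build R^c R^c^o _ (rideal_union_closed sKA' totA')).
  have prU : proper_rideal U.
    exists 1; apply/negP => /asboolP[|[_ [[N [prN _]] _ <-]]] /=.
      exact/negP/proper_rideal1.
    exact/negP/proper_rideal1.
  have sKU : {subset K <= U} by move=> x Kx; apply/asboolP; left.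
  exists (exist _ U (conj prU sKU)) => s As; apply/asboolP => x sx.
  by apply/asboolP; right; exists (sval s) => //; exists s.
exists M => //; split=> // N sMN prN.
have sKN : {subset K <= N} by move=> x /sKM /sMN.
have le_MN : le (exist _ M (conj prM sKM)) (exist _ N (conj prN sKN)).
  exact/asboolP.
by have /asboolP := maxM _ le_MN.
Qed.

(** A proper right ideal [K] and a right ideal inside the radical lie in a
    common maximal right ideal, hence so does their sum. *)
Lemma small_sub_jacobson L : {subset L <= jacobson R} -> small_rideal L.
Proof.
move=> sLJ K prK allLK.
have [M maxM sKM] := maximal_rideal_exists prK.
have [l [k [Ll Kk e1]]] := allLK 1.
case/negP: (proper_rideal1 maxM.1); rewrite e1.
apply: ridealD; last exact: sKM.
by move/sLJ/jacobsonP: Ll; apply.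
Qed.

End MaximalRightIdeals.

Section LeftIdentity.
Variable R : pzRingType.
Hypothesis regR : J_regular R.

Lemma J_regularP (a : R) : exists b : R, a - a * b * a \in jacobson R.
Proof.
have [b eb] := regR (\pi_(jacobson_quot R) a)%qT.
exists (repr b); rewrite Quotient.idealrBE; apply/eqP.
by rewrite {1}eb -{1}[b]reprK !jacobson_quot_piM.
Qed.

(** If [e] is a left identity modulo [J] on the previous generators and [b] is
    a quasi-inverse of [a' = (1 - e) a] modulo [J], then [e'] with
    [1 - e' = (1 - a' b) (1 - e)] still kills them on the left, and it sends
    [a] to [a' - a' b a']. *)
Lemma J_regular_left_identity (L : rideal R) (s : seq R) :
  {subset s <= L} ->
  exists2 e : R, e \in L & forall a, a \in s -> (1 - e) * a \in jacobson R.
Proof.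
elim: s => [|a s IHs] sL; first by exists 0 => //; apply: rideal0.
have [x sx|e Le es] := IHs; first by apply: sL; rewrite inE sx orbT.
have La : a \in L by apply: sL; rewrite mem_head.
pose a' := (1 - e) * a.
have La' : a' \in L.
  by rewrite /a' mulrBl mul1r; apply: ridealB => //; exact: ridealM.
have [b Jb] := J_regularP a'.
have def_e' : 1 - (e + a' * (b * (1 - e))) = (1 - a' * b) * (1 - e).
  by rewrite mulrBl mul1r mulrA opprD addrA.
exists (e + a' * (b * (1 - e))); first by apply: ridealD => //; exact: ridealM.
move=> x; rewrite inE def_e' -mulrA => /predU1P[->|sx].
  by rewrite -/a' mulrBl mul1r.
by apply: jacobsonMl; apply: es.
Qed.

End LeftIdentity.

Section Homomorphisms.
Variable R : pzRingType.
Implicit Types K L : rideal R.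

Definition left_mul (c : R) (x : R^c^o) : R^c^o := c * (x : R).

Lemma left_mul_linear c : linear (left_mul c).
Proof.
move=> a x y; rewrite /left_mul.
rewrite (_ : a *: x + y = (x : R) * (a : R) + y :> R) //.
by rewrite mulrDr mulrA.
Qed.

HB.instance Definition _ c :=
  GRing.isLinear.Build R^c R^c^o R^c^o _ (left_mul c) (left_mul_linear c).

Lemma linear_left_mul (g : {linear R^c^o -> R^c^o}) (x : R) :
  g x = (g 1 : R) * x :> R.
Proof.
have -> : g x = g ((x : R^c) *: (1 : R^c^o)).
  by congr (g _); rewrite -[LHS]mul1r.
by rewrite linearZ.
Qed.

Definition rideal_lmul (c : R) L : {pred R^c^o} :=
  fun y => `[< exists2 x : R, x \in L & y = c * x :> R >].

Lemma rideal_lmul_closed c L : GRing.submod_closed (rideal_lmul c L).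
Proof.
split=> [|a x y].
  by apply/asboolP; exists 0; [exact: rideal0 | rewrite mulr0].
move=> /asboolP[x' Lx' ->] /asboolP[y' Ly' ->]; apply/asboolP.
exists (x' * (a : R) + y'); first by apply: ridealD => //; exact: ridealM.
by rewrite mulrDr mulrA.
Qed.

HB.instance Definition _ c L :=
  GRing.isSubmodClosed.Build R^c R^c^o (rideal_lmul c L)
    (rideal_lmul_closed c L).

Lemma mem_rideal_lmul c L (x : R) : x \in L -> c * x \in rideal_lmul c L.
Proof. by move=> Lx; apply/asboolP; exists x. Qed.

Lemma n_generated_lmul n c L :
  n_generated n L -> n_generated n (rideal_lmul c L).
Proof.
move=> [a La]; exists (fun i => c * a i) => x; split.
  move=> /asboolP[y /La[r ->] ->]; exists r.
  by rewrite mulr_sumr; apply: eq_bigr => i _; rewrite mulrA.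
move=> [r ->]; apply/asboolP; exists (\sum_i a i * r i).
  by apply/La; exists r.
by rewrite mulr_sumr; apply: eq_bigr => i _; rewrite mulrA.
Qed.

Definition rideal_incl K L (sKL : {subset K <= L}) (x : rideal_mod K) :
  rideal_mod L := RidealMod (sKL _ (rideal_valP x)).

Lemma rideal_incl_linear K L (sKL : {subset K <= L}) : linear (rideal_incl sKL).
Proof. by move=> a x y; apply: val_inj. Qed.

HB.instance Definition _ K L (sKL : {subset K <= L}) :=
  GRing.isLinear.Build R^c (rideal_mod K) (rideal_mod L) _ (rideal_incl sKL)
    (rideal_incl_linear sKL).

(** Splitting [x] as [(1 - e) x + e x] inside [L] reduces the extension problem
    to [(1 - e) L], whatever [e] in [L] is: linearity alone gives
    [f (e x) = f e x] for the second summand. *)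
Lemma extends_of_lmul L (e : R) (f : {linear rideal_mod L -> R^c^o}) :
  e \in L ->
  (forall h : {linear rideal_mod (rideal_lmul (1 - e) L) -> R^c^o},
     extends_to_ring h) ->
  extends_to_ring f.
Proof.
move=> Le ext.
have sL : {subset rideal_lmul (1 - e) L <= L}.
  move=> _ /asboolP[x Lx ->]; rewrite mulrBl mul1r.
  by apply: ridealB => //; exact: ridealM.
have [g gE] := ext (f \o rideal_incl sL).
exists (left_mul ((g 1 : R) * (1 - e) + f (RidealMod Le))) => x.
pose y := RidealMod (mem_rideal_lmul (1 - e) (rideal_valP x)).
have ex : x = rideal_incl sL y + ((val x : R) : R^c) *: RidealMod Le.
  apply: val_inj; change (val x = (1 - e) * (val x : R) + e * (val x : R) :> R).
  by rewrite -mulrDl subrK mul1r.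
have -> : f x = g (val y) + ((val x : R) : R^c) *: f (RidealMod Le).
  by rewrite {1}ex linearD linearZ gE.
by rewrite [g (val y)]linear_left_mul mulrA [LHS]mulrDl.
Qed.

End Homomorphisms.

Theorem theorem11 (R : pzRingType) (n : nat) :
  J_regular R -> (1 <= n)%N ->
  (right_n_injective n R <->
   forall L : rideal R, n_generated n L -> small_rideal L ->
     forall f : {linear rideal_mod L -> R^c^o}, extends_to_ring f).
Proof.
move=> regR _; split=> [inj L genL _|small L genL f]; first exact: inj.
have [a aL] := genL.
have sL : {subset codom a <= L}.
  move=> _ /codomP[i ->]; apply/aL; exists (fun j => (j == i)%:R).
  rewrite (bigD1 i) //= eqxx mulr1 big1 ?addr0 // => j /negPf->.
  by rewrite mulr0.
have [e Le ae] := J_regular_left_identity regR sL.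
apply: (@extends_of_lmul _ _ _ f Le); apply: small.
  exact: n_generated_lmul.
apply: small_sub_jacobson => _ /asboolP[x /aL[r ->] ->].
rewrite mulr_sumr; apply: rpred_sum => i _; rewrite mulrA.
by apply/jacobsonMr/ae/codom_f.
Qed.
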